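(* Let $K$ be an arbitrary field and let $f,g\in K[x]$ be polynomials such that $\deg f\ge3$ and $\deg f\ge\deg g+2$. Then $$\left.\frac{\partial}{\partial t}\,\mathrm{res}_x\bigl(f(x),\,f'(x)+t\,g(x)\bigr)\right|_{t=0}=0 .$$
   Context: Here $t$ is an indeterminate, $f'$ is the formal derivative, and $\mathrm{res}_x(f,f'+tg)\in K[t]$ is the resultant with respect to $x$, i.e. the determinant of the Sylvester matrix of $f$ and $f'+tg$ regarded as polynomials in $x$ over $K[t]$ of formal degrees $\deg f$ and $\deg f-1$ respectively; $\partial/\partial t$ is the formal derivative on $K[t]$. *)

(* Defs.v *)
From mathcomp Require Import all_boot all_order all_algebra.
Set Implicit Arguments.
Unset Strict Implicit.
Unset Printing Implicit Defensive.
Import GRing.Theory.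
Local Open Scope ring_scope.

(* Sylvester matrix of p and q at formal degrees m and n: Sylvester_mx from
   mxpoly.v, with its row/column layout (coefficients in increasing degree,
   the n shifts of p first), but with m and n in place of the actual degrees
   (size p).-1 and (size q).-1. Meant for size p <= m.+1 and size q <= n.+1.
   The textbook layout with coefficients in decreasing degree changes the
   determinant by the sign (-1) ^+ (m * n) only, i.e. not at all for
   n = m.-1. *)
Definition fSylvester_mx (R : nzRingType) (m n : nat) (p q : {poly R}) :
    'M[R]_(n + m) :=
  \matrix_(i, j)
    match split i with
    | inl k => p`_(j - k) *+ (k <= j)%N
    | inr k => q`_(j - k) *+ (k <= j)%N
    end.

Definition fresultant (R : nzRingType) (m n : nat) (p q : {poly R}) : R :=
  \det (fSylvester_mx m n p q).

Lemma fresultantE (R : nzRingType) (p q : {poly R}) :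
  fresultant (size p).-1 (size q).-1 p q = resultant p q.
Proof.
congr (\det _); apply/matrixP=> i j.
by rewrite Sylvester_mxE mxE.
Qed.

(* Main.v *)
(* Let S and T be the Sylvester matrices of (f, f') and (0, g). If S is
   invertible, the derivative is det S * tr (T S^-1). Solving
   u f + v f' = g, this trace is that of multiplication by v on K[x]/(f), which
   equals the coefficient of x^(n-1) in v f' mod f = g, up to the leading
   coefficient of f, where n = deg f; it vanishes as deg g <= n - 2.
   The general case follows by deforming f to a separable polynomial h of the
   same degree: f + s (h - f) is separable over K(s), and one sets s = 0. *)
Require Import Defs.
From mathcomp Require Import all_boot all_order all_algebra.
From mathcomp Require Import fingroup perm zify ring.
Import GRing.Theory.
Local Open Scope ring_scope.

(** * First-order term of a determinant *)

Lemma deriv_horner0 (R : nzRingType) (p : {poly R}) : p^`().[0] = p`_1.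
Proof. by rewrite horner_coef0 coef_deriv. Qed.

Lemma coef1_prod1DX {R : comNzRingType} {I : Type} (r : seq I) (c : I -> R) :
  (\prod_(i <- r) (1 + 'X * (c i)%:P))`_0 = 1 /\
  (\prod_(i <- r) (1 + 'X * (c i)%:P))`_1 = \sum_(i <- r) c i.
Proof.
elim: r => [|i r [IH0 IH1]]; first by rewrite !big_nil !coef1.
rewrite !big_cons mulrDl mul1r -mulrA !coefD !coefXM /= coefCM IH0 IH1.
by rewrite addr0 mulr1 addrC.
Qed.

(** In the Leibniz expansion a permutation other than the identity moves some [i], hence also [s i];
    these two off-diagonal factors make its term divisible by ['X ^+ 2]. *)
Lemma coef1_det1DX (R : comNzRingType) n (M : 'M[R]_n) :
  (\det (1%:M + 'X *: map_mx polyC M))`_1 = \tr M.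
Proof.
rewrite coef_sum (bigD1 (1%g : 'S_n)) //= [X in _ + X]big1 ?addr0 => [|s s1].
  rewrite odd_perm1 mul1r (eq_bigr (fun i => 1 + 'X * (M i i)%:P)).
    by case: (coef1_prod1DX (index_enum 'I_n) (fun i => M i i)).
  by move=> i _; rewrite !mxE perm1 eqxx.
have [i si]: exists i, s i != i.
  apply/existsP; apply: contraR s1 => /existsPn fixs.
  by apply/eqP/permP => i; rewrite perm1; apply/eqP; move/negbNE: (fixs i).
rewrite (bigD1 i) //= (bigD1 (s i)) //= !mxE eq_sym (negbTE si) add0r.
rewrite [s i == _]eq_sym (inj_eq perm_inj) (negbTE si) add0r.
by rewrite -(mulrA 'X) mulrCA coefXM /= !coef0M coefX !(mul0r, mulr0).
Qed.

Lemma coef1_detDX (R : comUnitRingType) n (A B : 'M[R]_n) : A \in unitmx ->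
  (\det (map_mx polyC A + 'X *: map_mx polyC B))`_1
    = \det A * \tr (B *m invmx A).
Proof.
move=> uA; rewrite -coef1_det1DX -coefCM -det_map_mx mulrC -det_mulmx.
by rewrite mulmxDl mul1mx -scalemxAl -map_mxM mulmxKV.
Qed.

(** * Sylvester matrices at formal degrees and coprimality *)

Lemma fSylvester_mxE (R : nzRingType) m n (p q : {poly R}) :
  fSylvester_mx m n p q = col_mx (lin1_mx (poly_rV \o p \o* rVpoly))
                                 (lin1_mx (poly_rV \o q \o* rVpoly)).
Proof.
apply/matrixP=> i j; rewrite !mxE; case: (split i) => k; rewrite !mxE /=;
  by rewrite rVpoly_delta coefXnM ltnNge if_neg -mulrb.
Qed.

(** The size bounds ensure that [poly_rV] truncates neither product. *)
Lemma rVpoly_mul_fSylvester (R : comNzRingType) m n (p q : {poly R})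
    (u : 'rV_n) (v : 'rV_m) : (size p <= m.+1)%N -> (size q <= n.+1)%N ->
  rVpoly (row_mx u v *m fSylvester_mx m n p q) = rVpoly u * p + rVpoly v * q.
Proof.
move=> szp szq; rewrite fSylvester_mxE mul_row_col linearD /=.
have szM a b (w : 'rV[R]_a) (r : {poly R}) : (size r <= b.+1)%N ->
    (size (rVpoly w * r)%R <= a + b)%N.
  move=> szr; apply: leq_trans (size_polyMleq _ _) _.
  have := leq_add (size_poly a _ : (size (rVpoly w) <= a)%N) szr.
  by rewrite addnS; case: (_ + _)%N.
by rewrite !mul_rV_lin1 /= !poly_rV_K // ?szM // addnC szM.
Qed.

Lemma map_fSylvester_mx (R S : nzRingType) (phi : {rmorphism R -> S}) m n p q :
  map_mx phi (fSylvester_mx m n p q)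
    = fSylvester_mx m n (map_poly phi p) (map_poly phi q).
Proof.
by apply/matrixP=> i j; rewrite !mxE; case: (split i) => k;
  rewrite rmorphMn /= coef_map.
Qed.

Lemma map_fresultant {R S : comNzRingType} (phi : {rmorphism R -> S}) m n p q :
  phi (fresultant m n p q) = fresultant m n (map_poly phi p) (map_poly phi q).
Proof. by rewrite /fresultant -map_fSylvester_mx det_map_mx. Qed.

(** A kernel vector is a relation u p + v q = 0, so p divides v, which has smaller degree. Only p
    must attain its formal degree: derivatives may drop theirs in positive characteristic. *)
Lemma coprimep_fresultant_neq0 {K : fieldType} {m n} {p q : {poly K}} :
  size p = m.+1 -> (size q <= n.+1)%N -> coprimep p q ->
  fresultant m n p q != 0.
Proof.
move=> szp szq cpq; apply/det0P => -[w nz_w].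
move/(congr1 rVpoly); rewrite -[w]hsubmxK rVpoly_mul_fSylvester ?szp // linear0.
set u := lsubmx w; set v := rsubmx w => uv0.
have p_neq0 : p != 0 by rewrite -size_poly_eq0 szp.
have v0 : rVpoly v = 0.
  apply/eqP; apply: contraT => nz_v.
  have: p %| rVpoly v.
    rewrite -(Gauss_dvdpl _ cpq).
    by rewrite -(dvdp_addr _ (dvdp_mull (rVpoly u) (dvdpp p))) uv0 dvdp0.
  by move/(dvdp_leq nz_v); rewrite szp ltnNge size_poly.
move: uv0; rewrite v0 mul0r addr0 => /eqP.
rewrite mulf_eq0 (negbTE p_neq0) orbF => /eqP u0; case/eqP: nz_w.
by rewrite -[w]hsubmxK -/u -/v -[u]rVpolyK u0 -[v]rVpolyK v0 !linear0 row_mx0.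
Qed.

Lemma fresultant_neq0_coprimep {K : fieldType} {m n} {p q : {poly K}} :
  (0 < n + m)%N -> (size p <= m.+1)%N -> (size q <= n.+1)%N ->
  fresultant m n p q != 0 -> coprimep p q.
Proof.
move=> nm_gt0 szp szq nz_res; set S := fSylvester_mx m n p q.
have uS : S \in unitmx by rewrite unitmxE unitfE.
(* The two halves of [w] are Bezout coefficients; [0 < n + m] leaves room for the constant 1 in a
   row vector. *)
pose w := poly_rV 1 *m invmx S.
have := congr1 rVpoly (mulmxKV uS (poly_rV 1)).
rewrite -/w poly_rV_K ?size_poly1 // -[w]hsubmxK.
rewrite rVpoly_mul_fSylvester // => uv1.
apply/Bezout_coprimepP; exists (rVpoly (lsubmx w), rVpoly (rsubmx w)).
by rewrite uv1 eqpxx.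
Qed.

(** * Euler's dual basis *)

(* The functionals w |-> coefficient n of w b mod f, for b = drop_poly k.+1 f,
   are the coordinates on K[x]/(f), up to lead_coef f: this is Euler's dual
   basis for the trace form. *)
Lemma coef_modp_drop (K : fieldType) n (f w : {poly K}) k :
  size f = n.+2 -> (size w <= n.+1)%N -> (k <= n)%N ->
  ((w * drop_poly k.+1 f) %% f)`_n = lead_coef f * w`_k.
Proof.
move=> szf szw le_kn.
(* Splitting [w], then [f], at degree k gives w b = (drop w) f + r1 - r2 with b the dropped part of
   f. Only [r1] reaches degree n, and there only through its top coefficients. *)
pose r1 := take_poly k.+1 w * drop_poly k.+1 f.
pose r2 := drop_poly k.+1 w * take_poly k.+1 f.
have szr1 : (size r1 <= n.+1)%N.
  apply: leq_trans (size_polyMleq _ _) _; rewrite size_drop_poly szf.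
  have := size_take_poly k.+1 w; lia.
have szr2 : (size r2 <= n)%N.
  apply: leq_trans (size_polyMleq _ _) _; rewrite size_drop_poly.
  have := size_take_poly k.+1 f; lia.
rewrite -(@modpP _ (w * drop_poly k.+1 f) (drop_poly k.+1 w) f (r1 - r2));
  last first.
- rewrite szf ltnS (leq_trans (size_polyD _ _)) // size_polyN geq_max szr1.
  exact: leqW.
- rewrite -[in LHS](poly_take_drop k.+1 w).
  transitivity (drop_poly k.+1 w *
      (take_poly k.+1 f + drop_poly k.+1 f * 'X^(k.+1)) + (r1 - r2));
    last by rewrite poly_take_drop.
  by rewrite /r1 /r2; ring.
rewrite coefB (nth_default _ szr2) subr0 coefM.
rewrite (bigD1 (Ordinal (le_kn : (k < n.+1)%N))) //= big1 ?addr0 => [|i ne_ik].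
  rewrite coef_take_poly ltnSn coef_drop_poly lead_coefE szf mulrC.
  by congr (f`_ _ * _); lia.
rewrite coef_take_poly ltnS coef_drop_poly.
case: leqP => [le_ik|_]; last exact: mul0r.
rewrite [X in _ * X]nth_default ?mulr0 // szf.
by have: (i : nat) != k by []; lia.
Qed.

Lemma sum_drop_poly_deriv (R : nzRingType) n (f : {poly R}) :
  (size f <= n.+2)%N -> \sum_(k < n.+1) 'X^k * drop_poly k.+1 f = f^`().
Proof.
move=> szf; apply/polyP => j; rewrite coef_sum coef_deriv.
have [lt_nj|le_jn] := ltnP n j.
  rewrite [f`_ _]nth_default ?mul0rn; last exact: leq_trans szf _.
  apply: big1 => k _; rewrite coefXnM coef_drop_poly.
  case: ifP => // _; rewrite nth_default // (leq_trans szf) //.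
  by have := ltn_ord k; lia.
rewrite (eq_bigr (fun k : 'I_n.+1 => if (k < j.+1)%N then f`_j.+1 else 0)).
  rewrite -big_mkcond /= -(big_ord_widen _ (fun=> f`_j.+1)) //.
  by rewrite sumr_const card_ord.
move=> k _; rewrite coefXnM coef_drop_poly ltnNge ltnS; case: leqP => //= le_kj.
by congr (f`_ _); lia.
Qed.

(** * The derivative of the resultant, separable case *)

(* The derivative at t = 0, read off as the coefficient of t. *)
Definition dresultant {R : nzRingType} n (f g : {poly R}) : R :=
  (fresultant n.+1 n f^:P (f^`()^:P + 'X%:P * g^:P))`_1.

Lemma map_dresultant {R S : comNzRingType} (phi : {rmorphism R -> S}) n f g :
  phi (dresultant n f g) = dresultant n (map_poly phi f) (map_poly phi g).
Proof.
rewrite /dresultant -coef_map map_fresultant.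
have mapP (h : {poly R}) : map_poly (map_poly phi) h^:P = (map_poly phi h)^:P.
  by apply/polyP => i; rewrite !coef_map /= map_polyC.
by rewrite rmorphD rmorphM /= map_polyC /= map_polyX !mapP deriv_map.
Qed.

Lemma dresultant_trace (K : fieldType) n (f g : {poly K}) :
  let S := fSylvester_mx n.+1 n f f^`() in S \in unitmx ->
  dresultant n f g = \det S * \tr (fSylvester_mx n.+1 n 0 g *m invmx S).
Proof.
move=> S uS; rewrite -coef1_detDX //; congr (nth _ (polyseq (\det _)) _).
apply/matrixP => i j; rewrite !mxE; case: (split i) => k.
  by rewrite coef0 mul0rn mulr0 addr0 coef_map /= rmorphMn.
by rewrite coefD coefCM !coef_map !rmorphMn /= mulrnDl mulrnAr.
Qed.

Lemma dresultant_eq0_sep (K : fieldType) n (f g : {poly K}) :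
  size f = n.+2 -> (size g <= n)%N -> fresultant n.+1 n f f^`() != 0 ->
  dresultant n f g = 0.
Proof.
move=> szf szg nz_res.
have szf' : (size f^`() <= n.+1)%N.
  have := lt_size_deriv (_ : f != 0); rewrite -size_poly_eq0 szf ltnS; exact.
have f_neq0 : f != 0 by rewrite -size_poly_eq0 szf.
have cff' : coprimep f f^`().
  by apply: fresultant_neq0_coprimep nz_res; rewrite ?szf ?addnS.
set S := fSylvester_mx n.+1 n f f^`().
have uS : S \in unitmx by rewrite unitmxE unitfE.
rewrite dresultant_trace // -/S; apply/eqP; rewrite mulf_eq0; apply/orP; right.
set T := fSylvester_mx n.+1 n 0 g; set M := T *m invmx S.
have MS : M *m S = T by rewrite mulmxKV.
(* The upper rows of [T] are shifts of the zero polynomial, so only the lower right block of [M]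
   contributes to the trace. *)
have rowl k : row (lshift n.+1 k) M = 0.
  rewrite row_mul (_ : row _ T = 0) ?mul0mx //.
  by apply/rowP => j; rewrite !mxE (unsplitK (inl _)) coef0 mul0rn.
pose v k := rVpoly (rsubmx (row (rshift n k) M)).
pose u k := rVpoly (lsubmx (row (rshift n k) M)).
have uvE (k : 'I_n.+1) : u k * f + v k * f^`() = 'X^k * g.
  rewrite /u /v -rVpoly_mul_fSylvester ?szf // hsubmxK -row_mul -/S MS rowE.
  rewrite delta_mx_rshift rVpoly_mul_fSylvester ?size_poly0 //; last exact: leqW.
  by rewrite mulr0 add0r rVpoly_delta.
(* Since f' is invertible modulo f, this makes the lower right block the matrix of multiplication by
   [v ord0] on K[x]/(f). *)
have vE (k : 'I_n.+1) : f %| v k - 'X^k * v ord0.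
  rewrite -(Gauss_dvdpl _ cff').
  have -> : (v k - 'X^k * v ord0) * f^`() = ('X^k * u ord0 - u k) * f.
    apply/eqP; rewrite -subr_eq0; apply/eqP.
    transitivity (u k * f + v k * f^`() - 'X^k * (u ord0 * f + v ord0 * f^`())).
      by ring.
    by rewrite !uvE expr0 mul1r subrr.
  exact: dvdp_mull.
have MkE (k : 'I_n.+1) : M (rshift n k) (rshift n k) = (v k)`_k.
  by rewrite coef_rVpoly_ord !mxE.
apply/eqP; rewrite /mxtrace big_split_ord /= big1 ?add0r => [|k _]; last first.
  by have /rowP/(_ (lshift n.+1 k)) := rowl k; rewrite !mxE.
have nz_lead : lead_coef f != 0 by rewrite lead_coef_eq0.
apply: (mulfI nz_lead); rewrite mulr0 mulr_sumr.
(* Each diagonal entry is read off by its dual functional; the dual elements then add up to f'. *)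
transitivity (\sum_(k < n.+1) ((v ord0 * ('X^k * drop_poly k.+1 f)) %% f)`_n).
  apply: eq_bigr => k _; rewrite MkE.
  rewrite -(@coef_modp_drop _ n) ?size_poly ?leq_ord //.
  congr (_`_n); rewrite mulrA [v _ * _]mulrC -(subrK ('X^k * v ord0) (v k)).
  rewrite mulrDl modpD modp_eq0 ?add0r //; exact: dvdp_mulr.
have modp_sum (I : finType) (F : I -> {poly K}) :
    \sum_i (F i %% f) = (\sum_i F i) %% f.
  by rewrite (big_morph (fun p => p %% f) (fun p q => modpD f p q) (mod0p f)).
rewrite -coef_sum modp_sum -mulr_sumr sum_drop_poly_deriv ?szf //.
have := uvE ord0; rewrite expr0 mul1r => /(congr1 (fun p => p %% f)).
rewrite modpD modp_eq0 ?add0r ?dvdp_mull // => ->.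
(* Here deg f = n + 1, so g is its own remainder, and its coefficient of x^n vanishes. *)
by rewrite modp_small ?szf ?nth_default // ltnS leqW.
Qed.

(** * Deformation to a separable polynomial *)

(** With d = n + 2, x^d + x has derivative 1 if d = 0 in K; otherwise x^d + 1 is coprime to d
    x^(d-1). This covers finite fields too. *)
Lemma exists_separable_poly (K : fieldType) n :
  exists2 h : {poly K}, size h = n.+3 & coprimep h h^`().
Proof.
have [n0|nz_n] := eqVneq (n.+2%:R : K) 0.
  exists ('X^(n.+2) + 'X).
    by rewrite size_polyDl size_polyXn // size_polyX.
  rewrite derivD derivXn derivX -mulr_natr -polyC_natr n0 mulr0 add0r.
  exact: coprimep1.
exists ('X^(n.+2) + 1); first by rewrite size_polyDl size_polyXn // size_poly1.
rewrite derivD derivXn -[1]/(1%:P) derivC addr0 -scaler_nat coprimepZr //.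
rewrite coprimep_sym coprimep_expl //.
by rewrite exprSr coprimep_addl_mul ?coprimep1.
Qed.

(* In {poly {poly K}} the outer 'X is x and the inner 'X is t. *)
Theorem theorem1p6 (K : fieldType) (f g : {poly K})
    (hf : (3 <= (size f).-1)%N) (hfg : (size g + 2 <= size f)%N) :
  (fresultant (size f).-1 ((size f).-1 - 1)
     (f^:P) ((f^`())^:P + ('X)%:P * g^:P))^`().[0] = 0.
Proof.
rewrite deriv_horner0.
case szf: (size f) hf hfg => [|[|[|n]]] //= _; rewrite addn2 !ltnS subn1 => szg.
rewrite -/(dresultant n.+1 f g).
have [h szh cph] := exists_separable_poly K n.
(* The inner ['X] is now the deformation parameter s: s = 0 gives f, s = 1 gives h. *)
pose F : {poly {poly K}} := f^:P + 'X *: (h^:P - f^:P).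
have evalF c : map_poly (horner_eval c) F = f + c *: (h - f).
  apply/polyP => i; rewrite coef_map !(coefD, coefZ, coefN, coef_map) /=.
  by rewrite horner_evalE !hornerE.
have szF_le : (size F <= n.+3)%N.
  rewrite (leq_trans (size_polyD _ _)) // geq_max size_map_polyC szf leqnn.
  rewrite (leq_trans (size_scale_leq _ _)) // (leq_trans (size_polyD _ _)) //.
  by rewrite size_polyN !size_map_polyC szf szh maxnn.
have szF : size F = n.+3.
  apply/eqP; rewrite eqn_leq szF_le -szf -[f]addr0 -(scale0r (h - f)) -evalF.
  exact: size_poly.
have res_F : fresultant n.+2 n.+1 F F^`() != 0.
  (* If this resultant vanished in K[s], so would its value at s = 1, the nonzero resultant of h and
     h'. *)
  apply: contraTneq (coprimep_fresultant_neq0 (n := n.+1) szh _ cph) => [F0|].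
    have := map_fresultant (horner_eval 1) n.+2 n.+1 F F^`().
    have F1 : map_poly (horner_eval 1) F = h.
      by rewrite evalF scale1r addrC subrK.
    by rewrite F0 rmorph0 -deriv_map F1 => <-; rewrite eqxx.
  by have := lt_size_deriv (_ : h != 0); rewrite -size_poly_eq0 szh ltnS; exact.
have dF0 : dresultant n.+1 F g^:P = 0.
  (* K[s] embeds in the field K(s), over which the separable case applies to [F]. *)
  apply/eqP; rewrite -tofrac_eq0 map_dresultant; apply/eqP.
  apply: dresultant_eq0_sep.
  - rewrite size_map_inj_poly ?rmorph0 // => p q /eqP.
    by rewrite tofrac_eq => /eqP.
  - by rewrite (leq_trans (size_poly _ _)) // size_map_polyC.
  - by rewrite deriv_map -map_fresultant tofrac_eq0.
have := congr1 (horner_eval 0) dF0.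
rewrite map_dresultant evalF scale0r addr0 rmorph0.
suff -> : map_poly (horner_eval 0) g^:P = g by [].
by apply/polyP => i; rewrite !coef_map /= horner_evalE hornerC.
Qed.
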